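(* Assume $\mathrm{cov}(\mathcal{N})=\mathfrak{c}$. Let $S\subseteq(0,1)$ be a nonempty set. Then there exists a maximal $\mathsf{d}$-independent family $\mathcal{A}$ such that $\mathsf{d}[\mathcal{A}]=S$.
   Context: Let $\omega=\{0,1,2,\ldots\}$ and identify $n\in\omega$ with $\{0,\ldots,n-1\}$. $\mathcal{D}$ is the family of all $A\subseteq\omega$ for which the asymptotic density $\mathsf{d}(A):=\lim_{n\to\infty}|A\cap n|/n$ exists. For $\mathcal{A}\subseteq\mathcal{P}(\omega)$, $\langle\mathcal{A}\rangle$ denotes the field of subsets of $\omega$ generated by $\mathcal{A}$. For $\mathcal{F}\subseteq\mathcal{D}$, $\mathsf{d}[\mathcal{F}]:=\{\mathsf{d}(A):A\in\mathcal{F}\}$. A nonempty family $\mathcal{A}\subseteq\mathcal{D}$ is $\mathsf{d}$-independent if: (1) $\mathsf{d}(A)\in(0,1)$ for all $A\in\mathcal{A}$; (2) $\langle\mathcal{A}\rangle\subseteq\mathcal{D}$; (3) $\mathsf{d}(\bigcap\mathcal{F})=\prod_{A\in\mathcal{F}}\mathsf{d}(A)$ for every nonempty finite $\mathcal{F}\subseteq\mathcal{A}$. It is a maximal $\mathsf{d}$-independent family if it is $\mathsf{d}$-independent and not properly contained in another $\mathsf{d}$-independent family. $\mathcal{N}$ is the family of subsets of $2^\omega$ that are null for the completion $\lambda$ of the usual product probability measure on $2^\omega$; $\mathrm{cov}(\mathcal{N})$ is the least cardinality of a family $\mathcal{S}\subseteq\mathcal{N}$ with $\bigcup\mathcal{S}=2^\omega$.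 $\mathfrak{c}=2^{\aleph_0}$. *)

(* Defs.v *)
From HB Require Import structures.
From mathcomp Require Import all_boot all_order all_algebra.
From mathcomp Require Import finmap.
From mathcomp Require Import all_classical all_reals all_analysis.
From mathcomp Require Import measurable_realfun.

Set Implicit Arguments.
Unset Strict Implicit.
Unset Printing Implicit Defensive.

Import Order.TTheory GRing.Theory Num.Theory.
Import numFieldNormedType.Exports.

Local Open Scope classical_set_scope.
Local Open Scope card_scope.
Local Open Scope ring_scope.

(** * Asymptotic density *)

Definition density_seq (R : realType) (A : set nat) : R^nat :=
  fun n => #|` fset_set (A `&` `I_n)|%:R / n%:R.

Definition has_density (R : realType) : set (set nat) :=
  [set A | cvgn (density_seq R A)].

(* Meaningful only for [A] in [has_density R]. *)
Definition density (R : realType) (A : set nat) : R := limn (density_seq R A).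

Definition is_field_of_sets (T : Type) (G : set (set T)) : Prop :=
  [/\ G set0, setC_closed G & setU_closed G].

Definition generated_field (T : Type) (F : set (set T)) : set (set T) :=
  smallest (@is_field_of_sets T) F.

Definition d_independent (R : realType) (A : set (set nat)) : Prop :=
  [/\ A !=set0 /\ A `<=` has_density R,
      forall X, A X -> 0 < density R X < 1,
      generated_field A `<=` has_density R
    & forall F : set (set nat), finite_set F -> F !=set0 -> F `<=` A ->
        density R (\bigcap_(X in F) X) =
        \big[*%R/1]_(X \in F) density R X].

Definition maximal_d_independent (R : realType) (A : set (set nat)) : Prop :=
  d_independent R A /\
  forall B, d_independent R B -> A `<=` B -> B = A.

(** * The product measure on [nat -> bool] *)

Definition cylinder (s : seq bool) : set (nat -> bool) :=
  [set x | forall i, (i < size s)%N -> x i = nth false s i].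

Definition cantor_measurableType := g_sigma_algebraType (range cylinder).

Definition is_product_measure (R : realType)
    (P : probability cantor_measurableType R) : Prop :=
  forall s : seq bool, P (cylinder s) = (2 ^- size s)%:E.

Section product_measure_existence.
Variable R : realType.

Let D01 : set R := `[0, 1[%classic.
Let mD01 : measurable (D01 : set (measurableTypeR R)).
Proof. exact: measurable_itv. Qed.
Let P01 : set (measurableTypeR R) -> \bar R :=
  mrestr (@lebesgue_measure R) mD01.
HB.instance Definition _ := Measure.on P01.

Let P01_setT : P01 setT = 1%E.
Proof.
by rewrite /P01 /mrestr setTI lebesgue_measure_itv/= lte_fin ltr01 sube0.
Qed.
HB.instance Definition _ := Measure_isProbability.Build _ _ _ P01 P01_setT.

Let digits (x : measurableTypeR R) : cantor_measurableType :=
  fun n => odd (Num.truncn (2 ^+ n.+1 * x)).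

Let binval (s : seq bool) : nat := foldl (fun (v : nat) (b : bool) => (b + v.*2)%N) 0%N s.

Let half_truncn (y : R) : 0 <= y -> (Num.truncn (2 * y))./2 = Num.truncn y.
Proof.
move=> y0; apply/esym/eqP; rewrite truncn_eq//.
have y20 : 0 <= 2 * y by rewrite mulr_ge0.
have /andP[h1 h2] := truncn_itv y20.
set t := Num.truncn _ in h1 h2 *.
have e1 : t./2.*2%:R <= t%:R :> R.
  by rewrite ler_nat -{2}(odd_double_half t) leq_addl.
have e2 : t.+1%:R <= t./2.+1.*2%:R :> R.
  rewrite ler_nat -{1}(odd_double_half t) doubleS !ltnS -[X in (_ <= X)%N]add1n.
  by rewrite leq_add2r; case: odd.
move: e1 e2; rewrite -!muln2 !natrM => e1 e2.
apply/andP; split.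
- by rewrite -(ler_pM2r (ltr0n _ 2)) (le_trans e1)// (le_trans h1)// mulrC.
- by rewrite -(ltr_pM2r (ltr0n _ 2)) (lt_le_trans _ e2)// (le_lt_trans _ h2)// mulrC.
Qed.

Let cylinder_rcons s b x :
  cylinder (rcons s b) x <-> cylinder s x /\ x (size s) = b.
Proof.
rewrite /cylinder /= size_rcons; split=> [h|[h1 h2] i].
  split=> [i ltis|]; last by rewrite h// nth_rcons ltnn eqxx.
  by rewrite h 1?ltnW// nth_rcons ltis.
rewrite ltnS leq_eqVlt nth_rcons => /orP[/eqP ->|ltis].
  by rewrite ltnn eqxx.
by rewrite ltis h1.
Qed.

Let digits_cylinder s (x : R) : 0 <= x < 1 ->
  cylinder s (digits x) <-> Num.truncn (2 ^+ size s * x) = binval s.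
Proof.
move=> /andP[x0 x1]; elim/last_ind: s => [|s b IH].
  split=> [_|_ i]//; rewrite expr0 mul1r.
  by apply/eqP; rewrite truncn_eq// x0.
rewrite cylinder_rcons IH size_rcons /binval -cats1 foldl_cat /= -/(binval s).
rewrite /digits /= -(@half_truncn (2 ^+ size s * x)) ?mulr_ge0 ?exprn_ge0//.
rewrite mulrA -exprS; set t := Num.truncn _; split.
  by move=> [<- <-]; rewrite odd_double_half.
by move=> ->; rewrite half_bit_double oddD odd_double addbF oddb.
Qed.

Let measurable_digits : measurable_fun setT digits.
Proof.
have md n b : measurable [set x : measurableTypeR R | digits x n = b].
  have -> : [set x : measurableTypeR R | digits x n = b] =
      (fun x : measurableTypeR R => 2 ^+ n.+1 * x) @^-1`
      (\bigcup_(k in [set k | odd k = b]) [set y | Num.truncn y = k]).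
    apply/seteqP; split=> [x /= <-|x /= [k /= <- <-]//].
    by exists (Num.truncn (2 ^+ n.+1 * x)).
  rewrite -[X in measurable X]setTI.
  have mf : measurable_fun [set: measurableTypeR R]
      (fun x : measurableTypeR R => 2 ^+ n.+1 * x : measurableTypeR R).
    exact: mulrl_measurable.
  apply: mf => //; apply: bigcup_measurable => k _.
  have [k0|k0] := posnP k.
    rewrite k0; have -> : [set y : measurableTypeR R | Num.truncn y = 0%N] =
        [set` `]-oo, 1[%R].
      apply/seteqP; split=> y /=; rewrite in_itv/=.
        by move=> y0; have := truncnS_gt y; rewrite y0.
      by move=> y1; apply/eqP; rewrite -leqn0 truncn_le_nat.
    exact: measurable_itv.
  have -> : [set y : measurableTypeR R | Num.truncn y = k] =
      [set` `[k%:R, k.+1%:R[%R].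
    apply/seteqP; split=> y /=; rewrite in_itv/=.
      move=> yk; rewrite -yk truncnS_gt andbT truncn_le.
      by apply: ltW; apply: lt_le_trans ltr01 _; rewrite -truncn_gt0 yk.
    exact: truncn_def.
  exact: measurable_itv.
apply: (@measurability _ _ _ cantor_measurableType _ _ (range cylinder)) => //.
move=> _ [_ [s _ <-] <-]; rewrite setTI.
have -> : digits @^-1` cylinder s =
    \bigcap_(i in [set i | (i < size s)%N])
      [set x | digits x i = nth false s i] by [].
by apply: bigcap_measurableType => // i _; exact: md.
Qed.

HB.instance Definition _ := isMeasurableFun.Build _ _ _ _ digits measurable_digits.

Lemma exists_product_measure :
  exists P : probability cantor_measurableType R, is_product_measure P.
Proof.
exists (distribution P01 digits) => s.
rewrite /distribution /= /pushforward /P01 /= /mrestr.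
have vs : (binval s < 2 ^ size s)%N.
  elim/last_ind: s => [|s b IH]//.
  rewrite /binval -cats1 foldl_cat /= -/(binval s) cats1 size_rcons expnS mul2n.
  rewrite -leq_double doubleS in IH; apply: leq_trans IH.
  by rewrite ltnS -[X in (_ <= X)%N]add1n leq_add2r; case: b.
have p0 : 0 < 2 ^+ size s :> R by rewrite exprn_gt0.
have -> : digits @^-1` cylinder s `&` D01 =
  [set` `[(binval s)%:R / 2 ^+ size s, (binval s).+1%:R / 2 ^+ size s[%R].
  apply/seteqP; split=> x /=; rewrite !in_itv /=.
    move=> [+ Dx]; have x01 : 0 <= x < 1 by move: Dx; rewrite /D01/= in_itv.
    rewrite digits_cylinder// => /eqP.
    move: x01 => /andP[x0 _]; rewrite truncn_eq ?(mulr_ge0 (ltW p0))//.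
    by rewrite ler_pdivrMr// ltr_pdivlMr// mulrC.
  rewrite ler_pdivrMr// ltr_pdivlMr// => h.
  have x01 : 0 <= x < 1.
    move: h => /andP[h1 h2]; rewrite -(pmulr_lge0 x p0) (le_trans _ h1)//=.
    rewrite -(ltr_pM2r p0) mul1r (lt_le_trans h2)// -natrX ler_nat.
    exact: vs.
  split; last by rewrite /D01/= in_itv.
  by apply/digits_cylinder => //; apply: truncn_def; rewrite mulrC.
rewrite lebesgue_measure_itv /= lte_fin ltr_pM2r ?invr_gt0// ltr_nat leqnn.
by rewrite -EFinB -mulrBl -natrB// subSnn mul1r.
Qed.

End product_measure_existence.

(* [is_product_measure] determines the measure: cylinders (with the empty set)
   form a pi-system generating the sigma-algebra. *)
Definition cantor_measure (R : realType) : probability cantor_measurableType R :=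
  sval (cid (exists_product_measure R)).

Lemma cantor_measureP (R : realType) : is_product_measure (cantor_measure R).
Proof. exact: svalP (cid (exists_product_measure R)). Qed.

(* [mu.-negligible X]: X lies in a measurable set of measure zero, i.e. X is
   null for the completion of mu. *)
Definition null_ideal (R : realType) : set (set (nat -> bool)) :=
  [set X | (cantor_measure R).-negligible X].

(** * The covering number *)

Definition null_cover (R : realType) (S : set (set (nat -> bool))) : Prop :=
  S `<=` null_ideal R /\ \bigcup_(X in S) X = setT.

(* cov(N) = |K|: some null cover has cardinality |K| and none has smaller
   cardinality. *)
Definition cov_null_eq (R : realType) (T : Type) (K : set T) : Prop :=
  (exists2 S, null_cover R S & S #= K) /\
  (forall S, null_cover R S -> K #<= S).

(* Main.v *)
(* The family is built by recursion of length continuum.  At stage [X] one has an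
   independent family [A] with fewer than continuum many members, and adds a
   random set [Y] of a prescribed density [s]: each [n] is put in [Y]
   independently, with probability [p] if [n \in X] and [q] otherwise.  For each
   single set [B], the law of large numbers determines the densities of
   [B `&` Y] outside a null set, and by the hypothesis on cov(N) one choice of
   random bits works for all [B] in the field generated by [A] and [X].  If [X]
   could still be added to [A] and has density [x], take [p = s + e (1 - x)] and
   [q = s - e x] for a small [e > 0]: then [Y] has density [s] and is independent
   of [A], but [X `&` Y] has density [p x <> s x], so [X] can never be added
   later.  Hence the final family is maximal, while its densities were free. *)
Require Import Defs.
From mathcomp Require Import all_boot all_order all_algebra.
From mathcomp Require Import finmap.
From mathcomp Require Import all_classical all_reals all_analysis.
From mathcomp Require Import wochoice.
From mathcomp Require Import ring lra.

Set Implicit Arguments.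
Unset Strict Implicit.
Unset Printing Implicit Defensive.

Import Order.TTheory GRing.Theory Num.Theory.
Import numFieldNormedType.Exports.

Local Open Scope classical_set_scope.
Local Open Scope card_scope.
Local Open Scope ring_scope.

(** * Small sets and a well-order of the continuum *)

Definition strict_total (T : Type) (lt : T -> T -> Prop) :=
  [/\ well_founded lt, (forall x y z, lt x y -> lt y z -> lt x z)
    & forall x y, [\/ lt x y, x = y | lt y x]].

Section small.
Variable T : eqType.
Implicit Types P Q : set T.

Definition words P : set (seq (nat + T)) :=
  [set w : seq (nat + T) | forall t, inr t \in w -> P t].

(* Stands for "[P] has smaller cardinality than [T]" when [T] is the continuum;
   bounding words instead of letters is what counting field elements requires. *)
Definition small P : Prop :=
  ~ exists2 f : T -> seq (nat + T), injective f & forall t, words P (f t).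

Lemma words_cat P w1 w2 : words P w1 -> words P w2 -> words P (w1 ++ w2).
Proof. by move=> h1 h2 t; rewrite mem_cat => /orP[/h1|/h2]. Qed.

Lemma words_inl P n w : words P w -> words P (inl n :: w).
Proof. by move=> h t; rewrite in_cons => /orP[//|/h]. Qed.

(* Each letter is replaced by a self-delimiting block, announced by its length;
   this avoids the cardinal arithmetic [k * k = k]. *)
Lemma small_coded P Q (g : T -> seq (nat + T)) :
  set_inj Q g -> (forall u, Q u -> words P (g u)) -> small P -> small Q.
Proof.
move=> gI gP sP [f fI fQ]; apply: sP.
(* The announced length is a successor, so [inl 0] is free to mark a numeral. *)
pose tok (x : nat + T) : seq (nat + T) :=
  match x with
  | inl n => [:: inl 0%N; inl n]
  | inr u => inl (size (g u)).+1 :: g u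
  end.
pose code w := flatten [seq tok x | x <- w].
have codeI w w' : words Q w -> words Q w' -> code w = code w' -> w = w'.
  elim: w w' => [|x w IH] [|x' w'] //; rewrite /code /=.
  - by case: x' => [n|u].
  - by case: x => [n|u].
  move=> Qw Qw'; have Qt y v : words Q (y :: v) -> words Q v.
    by move=> h t tv; apply: h; rewrite in_cons tv orbT.
  have {}IH := IH w' (Qt _ _ Qw) (Qt _ _ Qw').
  case: x Qw => [n|u] Qw; case: x' Qw' => [n'|u'] Qw' //=.
    by move=> [-> /IH ->].
  move=> [+ /eqP]; move=> suu'; rewrite eqseq_cat// => /andP[/eqP guu' /eqP/IH ->].
  by rewrite (gI u u')// inE; [apply: Qw|apply: Qw']; rewrite in_cons eqxx.
exists (code \o f) => [t t' /= /codeI e|t].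
  by apply: fI; apply: e; apply: fQ.
have /= := fQ t; elim: (f t) => [//|x w IH] Qw; apply: words_cat; last first.
  by apply: IH => u uw; apply: Qw; rewrite in_cons uw orbT.
case: x Qw => [n|u] Qw; first by do 2 apply: words_inl.
by apply: words_inl; apply: gP; apply: Qw; rewrite mem_head.
Qed.

Lemma small_sub P Q : Q `<=` P -> small P -> small Q.
Proof.
move=> QP; apply: (@small_coded _ _ (fun u => [:: inr u])).
  by move=> u v _ _ [].
by move=> u Qu t; rewrite inE => /eqP[->]; exact: QP.
Qed.

Lemma smallU1 P a : small P -> small (P `|` [set a]).
Proof.
pose g u : seq (nat + T) := if u == a then [:: inl 0%N] else [:: inr u].
apply: (@small_coded _ _ g).
  move=> u v _ _; rewrite /g; case: eqP => [->|_]; case: eqP => [->|_]//.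
  by move=> [].
move=> u Pu t; rewrite /g; case: eqP => ua; rewrite inE => /eqP//[->].
by case: Pu.
Qed.

Lemma small_image P (Y : T -> T) : small P -> small (Y @` P).
Proof.
have [->|/set0P[u0 Pu0]] := eqVneq P set0; first by rewrite image_set0.
have inv v : exists u, (Y @` P) v -> P u /\ Y u = v.
  have [[u Pu <-]|nv] := pselect ((Y @` P) v); first by exists u.
  by exists u0.
have [h hP] := choice inv.
apply: (@small_coded _ _ (fun v => [:: inr (h v)])) => [v v'|v Yv t].
  by rewrite !inE => /hP[_ e] /hP[_ e'] [hh]; rewrite -e -e' hh.
by rewrite inE => /eqP[->]; have [] := hP _ Yv.
Qed.

Lemma exists_wf_order : exists lt : T -> T -> Prop, strict_total lt.
Proof.
have [R wR] := well_ordering_principle T.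
have wC : wo_chain R predT by apply: withinW.
have Rxx x : R x x by apply: (wo_chain_reflexive wC).
have Ranti x y : R x y -> R y x -> x = y.
  by move=> xy yx; apply: (wo_chain_antisymmetric wC) => //; rewrite xy.
have Rtot x y : R x y || R y x by apply: (wo_chainW wC).
have ltW x y : ~~ R y x -> R x y by case/orP: (Rtot x y) => // ->.
exists (fun x y => ~~ R y x); split.
- move=> x; apply: contrapT => nx.
  have [|z [[/asboolP nz zm] _]] := wR (fun y => `[< ~ Acc (fun x y => ~~ R y x) y >]).
    by exists x; apply/asboolP.
  apply: nz; constructor => y nzy; apply: contrapT => ny.
  by move: nzy; rewrite zm//; apply/asboolP.
(* Transitivity is read off the least element of [{x, y, z}]. *)
- move=> x y z xy yz.
  have [|m [[mA mm] _]] := wR [pred u | u \in [:: x; y; z]].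
    by exists x; rewrite !inE eqxx.
  have [mx my mz] : [/\ R m x, R m y & R m z].
    by split; apply: mm; rewrite !inE eqxx ?orbT.
  move: mA; rewrite !inE => /or3P[]/eqP ?; subst m.
  + apply/negP => zx; have xz := Ranti _ _ mz zx; subst z.
    by move: (ltW _ _ yz); rewrite (negbTE xy).
  + by rewrite mx in xy.
  + by rewrite my in yz.
- move=> x y; case/boolP: (R y x) => [yx|]; last by constructor 1.
  by case/boolP: (R x y) => [xy|]; [constructor 2; exact: Ranti|constructor 3].
Qed.

End small.

(** Words without letters from the alphabet are finite sequences of numbers, hence countably many;
    Cantor's diagonal set [D] refutes an injection into them. *)
Lemma small0 : small (set0 : set (set nat)).
Proof.
move=> [f fI f0].
have [h hI] : exists h : set nat -> nat, injective h.
  pose tok (x : nat + set nat) := if x is inl n then n else 0%N.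
  exists (fun A => @choice.pickle (seq nat) [seq tok x | x <- f A]) => A B.
  move=> /(pcan_inj choice.pickleK) e; apply: fI.
  have : forall w w', words set0 w -> words set0 w' ->
      [seq tok x | x <- w] = [seq tok x | x <- w'] -> w = w'.
    elim=> [|x w IH] [|x' w']//= Qw Qw' [xx' /IH ww'].
    rewrite ww'; try by move=> t tw; first
      [apply: (Qw t); rewrite in_cons tw orbT|apply: (Qw' t); rewrite in_cons tw orbT].
    case: x Qw xx' => [n|u] Qw; last by case: (Qw u); rewrite mem_head.
    case: x' Qw' => [n'|u'] Qw'; last by case: (Qw' u'); rewrite mem_head.
    by move=> /= ->.
  by apply=> //.
pose D := [set n | exists2 A, h A = n & ~ A n].
have [Dh|nDh] := pselect (D (h D)).
  by case: (Dh) => A /hI -> ; apply.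
by apply: (nDh); exists D.
Qed.

(* If [I] is the least segment of a given well-order that is not small, the
   continuum embeds into the words over [I]: order it first by the largest letter
   of the code of a point. *)
Lemma exists_small_wf_order : exists2 lt : set nat -> set nat -> Prop,
  strict_total lt & forall a, small [set b | lt b a].
Proof.
have [lt [wf tr tot]] := exists_wf_order (set nat).
have irr x : ~ lt x x by elim/(well_founded_ind wf): x => x IH xx; exact: (IH x).
have [sI|/existsNP[a0 nsa0]] := pselect (forall a, small [set b | lt b a]).
  by exists lt.
have [a [nsa sa]] : exists a, ~ small [set b | lt b a] /\
    forall b, lt b a -> small [set c | lt c b].
  elim/(well_founded_ind wf): a0 nsa0 => a IH nsa.
  have [sb|/existsNP[b /not_implyP[ba nsb]]] :=
    pselect (forall b, lt b a -> small [set c | lt c b]); last exact: IH nsb.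
  by exists a.
have [b0 b0a] : exists b0, lt b0 a.
  apply: contrapT => nb; apply: nsa; apply: small_sub small0 => b ba.
  by apply: nb; exists b.
have /contrapT[f fI fa] := nsa.
pose le b := [set c | lt c b] `|` [set b].
have leS b c : lt b c -> le b `<=` le c.
  by move=> bc x [xb|->]; left => //; exact: tr xb bc.
(* A bound [b] on all letters of [f t] is found by taking maxima, starting from [b0]. *)
have ex t : exists b, lt b a /\ words (le b) (f t).
  elim: (f t) (fa t) => [|x w IH] wa; first by exists b0.
  have [|b [ba wb]] := IH; first by move=> u uw; apply: wa; rewrite in_cons uw orbT.
  case: x wa => [n|u] wa; first by exists b; split=> //; exact: words_inl.
  have ua : lt u a by apply: wa; rewrite mem_head.
  have [bu|bu|ub] := tot b u.
  - exists u; split=> // v; rewrite inE => /orP[/eqP[->]|/wb/(leS _ _ bu)//].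
    by right.
  - subst b; exists u; split=> // v; rewrite inE => /orP[/eqP[->]|/wb//].
    by right.
  - exists b; split=> // v; rewrite inE => /orP[/eqP[->]|/wb//].
    by left.
have [r rP] := choice ex.
exists (fun x y => lt (r x) (r y) \/ r x = r y /\ lt x y); first split.
- suff H b x : r x = b ->
      Acc (fun x y => lt (r x) (r y) \/ r x = r y /\ lt x y) x by move=> x; exact: H.
  elim/(well_founded_ind wf): b x => b IHb x.
  elim/(well_founded_ind wf): x => x IHx rx; constructor => y [ryx|[ryx yx]].
    by apply: (IHb (r y)) => //; rewrite -rx.
  by apply: IHx => //; rewrite ryx.
- move=> x y z [xy|[xy xy']] [yz|[yz yz']].
  + by left; exact: tr yz.
  + by left; rewrite -yz.
  + by left; rewrite xy.
  + by right; split; [rewrite xy|exact: tr yz'].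
- move=> x y; have [h|h|h] := tot (r x) (r y).
  + by constructor 1; left.
  + have [k|k|k] := tot x y; first by constructor 1; right.
      by constructor 2.
    by constructor 3; right.
  + by constructor 3; left.
(* Predecessors [u] of [t] have [r u] at most [r t], so [f] codes them by words over [le (r t)];
   this set is small because [r t] precedes [a], the least point whose segment is not small. *)
move=> t; apply: (@small_coded _ (le (r t)) _ f).
- by move=> x y _ _ /fI.
- move=> u [h|[e _]]; last by rewrite -e; exact: (rP u).2.
  by move=> v /((rP u).2 v)/(leS _ _ h).
- by apply: smallU1; apply: sa; exact: (rP t).1.
Qed.

(** * Random sets *)

Section law_of_large_numbers.
Variable R : realType.
Implicit Types (f g : seq bool -> R) (n : nat).

(** Expectation of [f] on [n] independent fair bits, kept finite to avoid integrals over the Cantor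
    space. *)
Fixpoint avg n f : R :=
  if n is m.+1 then
    (avg m (fun w => f (false :: w)) + avg m (fun w => f (true :: w))) / 2
  else f [::].

Lemma eq_avg n f g : (forall w, size w = n -> f w = g w) -> avg n f = avg n g.
Proof.
elim: n f g => [|n IH] f g fg /=; first exact: fg.
by congr ((_ + _) / 2); apply: IH => w sw; apply: fg; rewrite /= sw.
Qed.

Lemma avg_affine n f (a b : R) : avg n (fun w => a * f w + b) = a * avg n f + b.
Proof. by elim: n f => [|n IH] f //=; rewrite !IH; field. Qed.

Lemma avg_const n (a : R) : avg n (fun=> a) = a.
Proof. by elim: n => [|n IH] //=; rewrite IH; field. Qed.

Lemma avgD m n f : avg (m + n) f = avg m (fun w => avg n (fun u => f (w ++ u))).
Proof. by elim: m f => [|m IH] f //=; rewrite !IH. Qed.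

(* [below p u] compares the dyadic rational with binary digits [u] to [p]. *)
Fixpoint below (p : R) (u : seq bool) : bool :=
  if u is b :: v then
    if p < 1 / 2 then ~~ b && below (2 * p) v else ~~ b || below (2 * p - 1) v
  else false.

(** The first bit settles the comparison on one half; the other half is the same problem for [2 * p]
    or [2 * p - 1], and averaging halves the error. *)
Lemma avg_below n (p : R) : 0 <= p <= 1 ->
  `|avg n (fun u => (below p u)%:R) - p| <= 2 ^- n.
Proof.
elim: n p => [|n IH] p p01 /=.
  by rewrite expr0 invr1 sub0r normrN ger0_norm//; lra.
rewrite exprS invfM; case: ltP => hp /=; rewrite avg_const.
  have /IH : 0 <= 2 * p <= 1 by lra.
  set q := avg _ _ => hq.
  have -> : (q + 0) / 2 - p = 2^-1 * (q - 2 * p) by field.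
  by rewrite normrM ger0_norm ?invr_ge0// ler_wpM2l ?invr_ge0.
have /IH : 0 <= 2 * p - 1 <= 1 by lra.
set q := avg _ _ => hq.
have -> : (1 + q) / 2 - p = 2^-1 * (q - (2 * p - 1)) by field.
by rewrite normrM ger0_norm ?invr_ge0// ler_wpM2l ?invr_ge0.
Qed.

Lemma avg_ge0 n f : (forall w, 0 <= f w) -> 0 <= avg n f.
Proof. by elim: n f => [|n IH] f f0 //=; rewrite divr_ge0// addr_ge0// IH. Qed.

Lemma avg_le1 n f : (forall w, f w <= 1) -> avg n f <= 1.
Proof.
elim: n f => [|n IH] f f1 //=; have := IH _ (fun w => f1 (false :: w)).
by have := IH _ (fun w => f1 (true :: w)); lra.
Qed.

Definition shift m (x : nat -> bool) : nat -> bool := fun i => x (m + i)%N.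

Lemma measurable_cylinder (s : seq bool) :
  measurable (cylinder s : set cantor_measurableType).
Proof. by apply: sub_sigma_algebra; exists s. Qed.

Lemma cylinder_rconsE s b x :
  cylinder (rcons s b) x <-> cylinder s x /\ x (size s) = b.
Proof.
rewrite /cylinder /= size_rcons; split=> [h|[h1 h2] i].
  split=> [i ltis|]; last by rewrite h// nth_rcons ltnn eqxx.
  by rewrite h 1?ltnW// nth_rcons ltis.
rewrite ltnS leq_eqVlt nth_rcons => /orP[/eqP ->|ltis].
  by rewrite ltnn eqxx.
by rewrite ltis h1.
Qed.

(** Markov's inequality on a cylinder. Splitting by the next bit reduces [n]; with no bit left the
    event is the whole cylinder or empty. *)
Lemma cylinder_markov n f (s : seq bool) (k : R) :
    0 < k -> (forall w, 0 <= f w) ->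
  let E := [set x | cylinder s x /\ k <= f (mkseq (shift (size s) x) n)] in
  measurable (E : set cantor_measurableType) /\
  (cantor_measure R E <= (2 ^- size s * avg n f / k)%:E)%E.
Proof.
move=> k0; elim: n f s => [|n IH] f s f0 E.
  have [kf|kf] := leP k (f [::]).
    have -> : E = cylinder s by apply/seteqP; split=> [x []|x] //; split.
    split; first exact: measurable_cylinder.
    rewrite cantor_measureP lee_fin -mulrA ler_peMr ?invr_ge0 ?exprn_ge0//=.
    by rewrite ler_pdivlMr// mul1r.
  have -> : E = set0 by apply/seteqP; split=> [x [_]|x] //=; rewrite leNgt kf.
  split=> //; rewrite measure0 lee_fin mulr_ge0 ?invr_ge0 ?(ltW k0)//.
  by rewrite mulr_ge0 ?invr_ge0 ?exprn_ge0 /=.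
have [m0 le0] := IH (fun w => f (false :: w)) (rcons s false) (fun=> f0 _).
have [m1 le1] := IH (fun w => f (true :: w)) (rcons s true) (fun=> f0 _).
set E0 := (X in measurable X) in m0 le0; set E1 := (X in measurable X) in m1 le1.
have EE : E = E0 `|` E1.
  have sh b x : x (size s) = b ->
      mkseq (shift (size s) x) n.+1 = b :: mkseq (shift (size (rcons s b)) x) n.
    move=> <-; rewrite /mkseq /= {1}/shift addn0; congr cons.
    rewrite (iotaDl 1 0) -map_comp; apply: eq_map => i /=.
    by rewrite /shift size_rcons addnA addn1.
  apply/seteqP; split=> [x [sx kx]|x [] [/cylinder_rconsE[sx xb] kx]].
  - have := kx; rewrite (sh _ _ erefl); case xb: (x (size s)) => ?; [right|left];
      by split=> //; apply/cylinder_rconsE.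
  - by split=> //; rewrite (sh _ _ xb).
  - by split=> //; rewrite (sh _ _ xb).
rewrite EE; split; first exact: measurableU.
apply: le_trans (measureU2 _ _ _) _ => //.
apply: le_trans (leeD le0 le1) _; rewrite -EFinD lee_fin !size_rcons /= exprS.
rewrite le_eqVlt; apply/orP; left; apply/eqP; field.
by rewrite lt0r_neq0//= expf_neq0.
Qed.

(** Apply [1 + z <= expR z] at [z = 2 * y ^+ 2 - y] and note that [(1 + y) * (1 + z) = 1 + y ^+ 2 *
    (1 + 2 * y)], which is at least [1] by the bound on [y]. *)
Lemma expR_le1D (y : R) : - (1 / 2) <= y -> expR (y - 2 * y ^+ 2) <= 1 + y.
Proof.
move=> hy; have y1 : 0 < 1 + y by lra.
have := expR_ge1Dx (2 * y ^+ 2 - y); rewrite -opprB expRN => h.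
have h0 : 0 < 1 - (y - 2 * y ^+ 2) by nra.
have h1 : expR (y - 2 * y ^+ 2) * (1 - (y - 2 * y ^+ 2)) <= 1.
  by rewrite mulrC -ler_pdivlMr ?expR_gt0// mul1r.
have : 1 <= (1 + y) * (1 - (y - 2 * y ^+ 2)) by nra.
by move=> /(le_trans h1); rewrite ler_pM2r.
Qed.

Definition offset n := (\sum_(i < n) i)%N.

(* Membership of [n] is decided by the [n]-th block of bits of [x], which has
   length [n] and makes it an event of probability within [2^-n] of [p n]. *)
Definition random_set (p : nat -> R) (x : nat -> bool) : set nat :=
  [set n | below (p n) (mkseq (shift (offset n) x) n)].

(** * A strong law of large numbers by betting *)

Section bounded_martingale.
Variables (p c : nat -> R).
Hypothesis c01 : forall n, 0 <= c n <= 1.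

Let mean n : R := avg n (fun u => (below (p n) u)%:R).

Let mean01 n : 0 <= mean n <= 1.
Proof.
apply/andP; split; first by apply: avg_ge0 => w; rewrite ler0n.
by apply: avg_le1 => w; case: below.
Qed.

(* The capital of a gambler staking the fraction [e] at each step has average [1],
   but grows exponentially if the sums of gains stay of linear size. *)
Fixpoint wealth (e : R) N n (w : seq bool) : R :=
  if N is N'.+1 then
    (1 + e * (c n * ((below (p n) (take n w))%:R - mean n))) *
    wealth e N' n.+1 (drop n w)
  else 1.

Fixpoint total_length N n := (if N is N'.+1 then n + total_length N' n.+1 else 0)%N.

(** Each factor has mean one over its own block of bits, since the bet is on the deviation from the
    exact probability [mean n] rather than from [p n]. *)
Lemma avg_wealth e N n : avg (total_length N n) (wealth e N n) = 1.
Proof.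
elim: N n => [|N IH] n //=; rewrite avgD.
rewrite (@eq_avg n _ (fun w => (e * c n) * (below (p n) w)%:R +
    (1 - e * c n * mean n))); last first.
  move=> w sw; rewrite (@eq_avg _ _ (fun u =>
    ((1 + e * (c n * ((below (p n) w)%:R - mean n))) * wealth e N n.+1 u + 0))).
    by rewrite avg_affine IH; ring.
  by move=> u _; rewrite addr0 take_size_cat// drop_size_cat.
by rewrite avg_affine -/(mean n); ring.
Qed.

Let gain x i : R := c i * (\1_(random_set p x) i - mean i).

Let abs_gain x i : `|gain x i| <= 1.
Proof.
have := c01 i; have := mean01 i; rewrite /gain indicE ler_norml.
by case: (_ \in _) => /=; nra.
Qed.

Lemma wealthE e N n x :
  wealth e N n (mkseq (shift (offset n) x) (total_length N n)) =
  \prod_(n <= i < n + N) (1 + e * gain x i).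
Proof.
elim: N n => [|N IH] n /=; first by rewrite addn0 big_geq.
rewrite addnS big_ltn ?ltnS ?leq_addr// -addSn -IH.
rewrite /mkseq iotaD map_cat take_size_cat ?size_map ?size_iota//.
rewrite drop_size_cat ?size_map ?size_iota//; congr (_ * wealth _ _ _ _).
  rewrite /gain indicE; suff -> : (n \in random_set p x) =
    below (p n) (mkseq (shift (offset n) x) n) by [].
  by apply/idP/idP; rewrite in_setE.
rewrite add0n -[X in iota X _]addn0 iotaDl -map_comp; apply: eq_map => i /=.
by rewrite /shift /offset big_ord_recr/= addnA.
Qed.

(** Each factor is bounded below by [expR_le1D] with [y = e * gain x i], where [|y| <= 1 / 2] and
    [y ^+ 2 <= e ^+ 2]. *)
Lemma wealth_ge e N x : `|e| <= 1 / 2 ->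
  expR (e * (\sum_(i < N) gain x i) - 2 * e ^+ 2 * N%:R) <=
  wealth e N 0 (mkseq (shift 0 x) (total_length N 0)).
Proof.
move=> he; have -> : shift 0 x = shift (offset 0) x by rewrite /offset big_ord0.
rewrite wealthE add0n big_mkord; elim: N => [|N IH].
  by rewrite !big_ord0 mulr0 mulr0 subr0 expR0.
rewrite !big_ord_recr/=; set g := gain x N.
have -> : e * (\sum_(i < N) gain x i + g) - 2 * e ^+ 2 * N.+1%:R =
    (e * (\sum_(i < N) gain x i) - 2 * e ^+ 2 * N%:R) + (e * g - 2 * e ^+ 2).
  by rewrite -natr1; ring.
rewrite expRD ler_pM ?expR_ge0//.
have g1 : `|g| <= 1 := abs_gain x N.
have e2 : (e * g) ^+ 2 <= e ^+ 2.
  rewrite exprMn ler_piMr ?sqr_ge0// -real_normK ?num_real//.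
  by rewrite expr_le1.
have eg : `|e * g| <= 1 / 2 by rewrite normrM; apply: le_trans he; rewrite ler_piMr.
apply: le_trans (expR_le1D _); last by move: eg; rewrite ler_norml => /andP[].
by rewrite ler_expR lerD2l lerN2 ler_wpM2l.
Qed.

Lemma wealth_ge0 e N n w : `|e| <= 1 / 2 -> 0 <= wealth e N n w.
Proof.
move=> he; elim: N n w => [|N IH] n w //=; rewrite mulr_ge0//.
set b : R := _%:R; have : `|c n * (b - mean n)| <= 1.
  have := c01 n; have := mean01 n; rewrite /b ler_norml.
  by case: below => /=; nra.
move: he; rewrite !ler_norml => /andP[? ?] /andP[? ?]; nra.
Qed.

(** Borel-Cantelli: the wealth reaches [expR (e ^+ 2 * N)] with probability at most
    [expR (- e ^+ 2) ^+ N], a summable bound, and below that level [wealth_ge] bounds the sum of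
    gains. *)
Lemma negligible_gain e : e != 0 -> `|e| <= 1 / 2 ->
  (cantor_measure R).-negligible
    [set x | ~ \forall N \near \oo, e * (\sum_(i < N) gain x i) < 3 * e ^+ 2 * N%:R].
Proof.
move=> e0 he.
pose F N : set cantor_measurableType :=
  [set x | cylinder [::] x /\ expR (e ^+ 2 * N%:R) <=
    wealth e N 0 (mkseq (shift 0 x) (total_length N 0))].
have FP N := @cylinder_markov (total_length N 0) (wealth e N 0) [::] _
  (expR_gt0 (e ^+ 2 * N%:R)) (fun w => wealth_ge0 N 0 w he).
have mF N : measurable (F N) := (FP N).1.
pose r := expR (- e ^+ 2).
have leF N : (cantor_measure R (F N) <= (r ^+ N)%:E)%E.
  apply: le_trans (FP N).2 _; rewrite avg_wealth expr0 invr1 !mul1r.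
  by rewrite -expRN lee_fin -mulNr mulrC expRM_natl.
have e2 : 0 < e ^+ 2 by rewrite lt_neqAle eq_sym sqrf_eq0 e0 sqr_ge0.
have r1 : `|r| < 1 by rewrite ger0_norm ?expR_ge0// /r -expR0 ltr_expR oppr_lt0.
have lim0 : cantor_measure R (lim_sup_set F) = 0%E.
  apply: lim_sup_set_cvg0 => //.
  apply: (@le_lt_trans _ _ (\sum_(n <oo) (r ^+ n)%:E)%E).
    by apply: lee_nneseries => // n _; exact: leF.
  have cvgr : eseries (fun n => (r ^+ n)%:E) @ \oo --> (1 / (1 - r))%:E.
    apply: cvg_EFin; first by apply: nearW => n; rewrite /eseries/= sumEFin.
    rewrite [X in X @ _ --> _](_ : _ = series (geometric 1 r)).
      exact: cvg_geometric_series.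
    apply/funext => n; rewrite /= /eseries/= sumEFin/= /series/=.
    by apply: eq_bigr => i _; rewrite mul1r.
  have -> : (\sum_(n <oo) (r ^+ n)%:E)%E = (1 / (1 - r))%:E by apply/cvg_lim.
  exact: ltry.
exists (lim_sup_set F); split=> //.
  apply: bigcap_measurable => // k _; exact: bigcup_measurable.
move=> x /= nx n _; apply: contrapT => nF; apply: nx.
exists n => // N /= nN; rewrite ltNge; apply/negP => h; apply: nF.
exists N => //; split=> //; apply: le_trans (wealth_ge N x he).
by rewrite ler_expR; move: h; lra.
Qed.


Hypothesis p01 : forall n, 0 <= p n <= 1.

(** Both signs of [e = 1 / (k + 2)] in [negligible_gain] bound the sum of gains by [3 * e * N] in
    absolute value; replacing [mean] by [p] costs at most the sum of the [2 ^- i], hence at most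
    [2]. *)
Lemma weighted_lln : null_ideal R [set x | ~ ((fun N => (\sum_(i < N)
  c i * (\1_(random_set p x) i - p i)) / N%:R : R) @ \oo --> (0 : R))].
Proof.
pose bad e : set cantor_measurableType := [set x |
  ~ \forall N \near \oo, e * (\sum_(i < N) gain x i) < 3 * e ^+ 2 * N%:R].
pose e_ k : R := k.+2%:R^-1.
have e0 k : 0 < e_ k by rewrite invr_gt0.
have e12 k : `|e_ k| <= 1 / 2.
  by rewrite gtr0_norm// div1r lef_pV2 ?posrE// ler_nat.
apply: (@negligibleS _ _ _ _ (\bigcup_k (bad (e_ k) `|` bad (- e_ k)))); last first.
  apply: negligible_bigcup => k; apply: negligibleU; apply: negligible_gain => //.
  - exact: lt0r_neq0.
  - by rewrite oppr_eq0 lt0r_neq0.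
  - by rewrite normrN.
move=> x /= nx; apply: contrapT => nb; apply: nx.
have good k : (\forall N \near \oo, `|\sum_(i < N) gain x i| <= 3 * e_ k * N%:R).
  have : ~ (bad (e_ k) `|` bad (- e_ k)) x by move=> h; apply: nb; exists k.
  move=> /not_orP[/contrapT h1 /contrapT h2].
  near=> N.
  have h3 : e_ k * (\sum_(i < N) gain x i) < 3 * e_ k ^+ 2 * N%:R by near: N.
  have h4 : - e_ k * (\sum_(i < N) gain x i) < 3 * (- e_ k) ^+ 2 * N%:R by near: N.
  move: h3 h4; rewrite sqrrN expr2 ler_norml => h3 h4.
  by apply/andP; split; rewrite -(ler_pM2l (e0 k)); lra.
have err N : `|\sum_(i < N) c i * (mean i - p i)| <= 2.
  apply: le_trans (ler_norm_sum _ _ _) _.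
  apply: (@le_trans _ _ (\sum_(i < N) (2 ^- i : R))).
    apply: ler_sum => i _; rewrite normrM -[leRHS]mul1r ler_pM//; last exact: avg_below.
    by rewrite ger0_norm; case/andP: (c01 i).
  have -> : \sum_(i < N) (2 ^- i : R) = 2 - 2 * 2 ^- N.
    elim: N => [|N IH]; first by rewrite big_ord0 expr0 invr1; ring.
    by rewrite big_ord_recr/= IH exprS; field; rewrite expf_neq0.
  by rewrite gerBl mulr_ge0// invr_ge0 exprn_ge0.
apply/cvgr0Pnorm_lt => eps eps0.
(* Half of [eps] pays for the gains, by [3 / (k + 2) < eps / 2]; the other half pays for the error
   [2] once [N > 4 / eps]. *)
pose k := Num.truncn (6 / eps).
have ke : 3 * e_ k < eps / 2.
  have : 6 / eps < k.+2%:R by apply: lt_trans (truncnS_gt _) _; rewrite ltr_nat.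
  rewrite ltr_pdivrMr// => h; rewrite /e_ ltr_pdivrMr//; lra.
have gk := good k.
near=> N.
have N0 : 0 < (N%:R : R) by near: N; exact: nbhs_infty_gtr.
have Ne : 4 / eps < (N%:R : R) by near: N; exact: nbhs_infty_gtr.
rewrite normrM normfV (gtr0_norm N0) ltr_pdivrMr//.
have -> : \sum_(i < N) c i * (\1_(random_set p x) i - p i) =
    \sum_(i < N) gain x i + \sum_(i < N) c i * (mean i - p i).
  by rewrite -big_split/=; apply: eq_bigr => i _; rewrite /gain; ring.
apply: le_lt_trans (ler_normD _ _) _.
have h1 : `|\sum_(i < N) gain x i| <= 3 * e_ k * N%:R by near: N.
have h2 := err N.
have h3 : 3 * e_ k * N%:R < eps / 2 * N%:R by rewrite ltr_pM2r.
by move: Ne; rewrite ltr_pdivrMr// => h4; lra.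
Unshelve. all: by end_near.
Qed.

End bounded_martingale.

End law_of_large_numbers.

(** * Generated fields and independent families *)

Section generated_field.
Variable T : Type.
Implicit Types (A C : set (set T)) (B X Y : set T).

Lemma generated_field_sub A C :
  is_field_of_sets C -> A `<=` C -> generated_field A `<=` C.
Proof. by move=> Cf AC B; apply. Qed.

Lemma sub_generated_field A : A `<=` generated_field A.
Proof. by move=> B AB C [_]; apply. Qed.

Lemma generated_fieldS A A' : A `<=` A' -> generated_field A `<=` generated_field A'.
Proof. by move=> AA' B gB C [Cf A'C]; apply: gB; split=> // X /AA'/A'C. Qed.

Lemma generated_field_field A : is_field_of_sets (generated_field A).
Proof.
split=> [C [[]]//|B gB C h|B B' gB gB' C h].
  by case: (h) => -[_ + _] _; apply; exact: (gB C h).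
by case: (h) => -[_ _ +] _; apply; [exact: (gB C h)|exact: (gB' C h)].
Qed.

Lemma generated_fieldT A : generated_field A setT.
Proof. by have [g0 gC _] := generated_field_field A; rewrite -setC0; exact: gC. Qed.

Lemma generated_fieldI A B B' :
  generated_field A B -> generated_field A B' -> generated_field A (B `&` B').
Proof.
have [_ gC gU] := generated_field_field A => gB gB'.
by rewrite -[B `&` B']setCK setCI; apply: (gC); apply: gU; exact: gC.
Qed.

Lemma generated_fieldD A B B' :
  generated_field A B -> generated_field A B' -> generated_field A (B `\` B').
Proof.
have [_ gC _] := generated_field_field A => gB gB'.
by rewrite setDE; apply: generated_fieldI => //; exact: gC.
Qed.

Lemma generated_field_bigcap A (F : set (set T)) :
  finite_set F -> F `<=` A -> generated_field A (\bigcap_(X in F) X).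
Proof.
move=> /finite_seqP[s ->] sA; elim: s sA => [|X s IH] sA.
  rewrite (_ : [set` [::]] = set0) ?bigcap_set0; last by apply/seteqP; split.
  exact: generated_fieldT.
rewrite (_ : [set` X :: s] = X |` [set` s]); last first.
  apply/seteqP; split=> Y /=; rewrite in_cons.
    by move=> /orP[/eqP|]; [left|right].
  by move=> [->|->]; rewrite ?eqxx ?orbT.
rewrite bigcap_setU1; apply: generated_fieldI.
  by apply: sub_generated_field; apply: sA; rewrite /= mem_head.
by apply: IH => Y Ys; apply: sA; rewrite /= in_cons Ys orbT.
Qed.

(** Proper differences replace complement and union because density passes to them by subtraction.
    The sets whose trace on every member of [C] stays in [C] form a field. *)
Lemma generated_field_ind A C : C setT ->
  (forall B X, C B -> A X -> C (B `&` X)) ->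
  (forall B B', B' `<=` B -> C B -> C B' -> C (B `\` B')) ->
  generated_field A `<=` C.
Proof.
move=> CT CI CD; pose D := [set E | forall B, C B -> C (B `&` E)].
have DC E : D E -> D (~` E).
  move=> DE B CB; rewrite -setDE -[B `\` E]set0U -(setDv B) -setDIr.
  by apply: CD => //; exact: DE.
have DI E E' : D E -> D E' -> D (E `&` E').
  by move=> DE DE' B CB; rewrite setIA; exact/DE'/DE.
suff gD : generated_field A `<=` D by move=> B /gD/(_ _ CT); rewrite setTI.
apply: generated_field_sub => [|X AX B CB]; last exact: CI.
split=> [B CB|//|E E' DE DE'].
  by rewrite setI0 -(setDv B); exact: CD.
by rewrite -[E `|` E']setCK setCU; apply: (DC); apply: DI; exact: DC.
Qed.

(** The sets so described form a field, as complement and union act separately inside and outside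
    [Y]. *)
Lemma generated_fieldU1 A Y B : generated_field (A `|` [set Y]) B ->
  exists B1 B2, [/\ generated_field A B1, generated_field A B2 &
    B = (B1 `&` Y) `|` (B2 `\` Y)].
Proof.
have [g0 gC gU] := generated_field_field A.
apply: (@generated_field_sub _ [set B | exists B1 B2,
  [/\ generated_field A B1, generated_field A B2 &
    B = (B1 `&` Y) `|` (B2 `\` Y)]]).
  split=> [|E [B1 [B2 [g1 g2 ->]]]|E E' [B1 [B2 [g1 g2 ->]]] [B1' [B2' [g1' g2' ->]]]].
  - by exists set0, set0; split=> //; rewrite set0I set0D setU0.
  - exists (~` B1), (~` B2); split; [exact: gC|exact: gC|].
    by apply/seteqP; split=> x /=; have [?|?] := pselect (Y x); tauto.
  - exists (B1 `|` B1'), (B2 `|` B2'); split; [exact: gU|exact: gU|].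
    by apply/seteqP; split=> x /=; tauto.
move=> X [AX|->].
  exists X, X; split; [exact: sub_generated_field|exact: sub_generated_field|].
  by rewrite setUIDK.
exists setT, set0; split=> //; first exact: generated_fieldT.
by rewrite setTI set0D setU0.
Qed.

End generated_field.

(** * Coding a generated field by words *)

Section postfix.
Variable T : Type.
Implicit Types (A : set (set T)) (X : set T).

(* Postfix notation for the elements of the field generated by [X] and the letters
   [inr B]; the numbers [0], [1], [2] stand for [set0], complement and union. *)
Definition postfix_step X (st : seq (set T)) (x : nat + set T) : seq (set T) :=
  match x, st with
  | inr B, _ => B :: st
  | inl 0%N, _ => set0 :: st
  | inl 1%N, B :: st' => ~` B :: st'
  | inl 2%N, B :: B' :: st' => B' `|` B :: st'
  | inl _, _ => X :: st
  end.

Definition postfix_eval X (w : seq (nat + set T)) : set T :=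
  head set0 (foldl (postfix_step X) [::] w).

(** The letters come from [A] only, so the field with [X] added is indexed by the very words that
    [small A] bounds. *)
Lemma generated_field_words A X :
  generated_field (A `|` [set X]) `<=` postfix_eval X @` words A.
Proof.
(* Quantifying over the stack [st] lets words be evaluated one after the other. *)
pose C := [set B | exists2 w, words A w &
  forall st, foldl (postfix_step X) st w = B :: st].
suff gC : generated_field (A `|` [set X]) `<=` C.
  by move=> B /gC[w Aw wB]; exists w => //; rewrite /postfix_eval wB.
apply: generated_field_sub.
  split=> [|B [w Aw wB]|B B' [w Aw wB] [w' Aw' wB']].
  - by exists [:: inl 0%N] => //; exact: words_inl.
  - exists (w ++ [:: inl 1%N]); first by apply: words_cat => //; exact: words_inl.
    by move=> st; rewrite foldl_cat wB.
  - exists (w ++ w' ++ [:: inl 2%N]).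
      by do 2 (apply: words_cat => //); exact: words_inl.
    by move=> st; rewrite !foldl_cat wB wB'.
(* [inl 3] falls through to the last case of [postfix_step], which pushes [X]. *)
move=> B [AB|->]; last by exists [:: inl 3%N] => //; exact: words_inl.
by exists [:: inr B] => // t; rewrite inE => /eqP[->].
Qed.

End postfix.

(** * Asymptotic density and independence *)

Section density.
Variable R : realType.
Implicit Types (B X Y : set nat) (A F : set (set nat)).

Lemma density_seqE B n : density_seq R B n = (\sum_(i < n) \1_B i) / n%:R.
Proof.
rewrite /density_seq; congr (_ / _); elim: n => [|n IH].
  by rewrite II0 setI0 fset_set0 cardfs0 big_ord0.
rewrite big_ord_recr/= -IH IIS setIUr indicE.
have fI : finite_set (B `&` `I_n) by apply: finite_setIr; exact: finite_II.
case: (boolP (n \in B)) => nB; last first.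
  rewrite addr0; suff -> : B `&` [set n] = set0 by rewrite setU0.
  by apply/seteqP; split=> x //= -[Bx xn]; move: nB; rewrite -xn notin_setE.
have -> : B `&` [set n] = [set n].
  by apply/seteqP; split=> [x []//|x /= ->]; split=> //; exact: set_mem.
rewrite fset_setU// fset_set1 fsetUC cardfsU1 in_fset_set//.
suff /negbTE -> : n \notin B `&` `I_n by rewrite /= add1n -natr1.
by rewrite notin_setE => -[_] /=; rewrite ltnn.
Qed.

Lemma cvg_density B d : density_seq R B @ \oo --> d ->
  has_density R B /\ density R B = d.
Proof. by move=> Bd; split; [apply/cvg_ex; exists d|exact/cvg_lim]. Qed.

Lemma densityP B : has_density R B -> density_seq R B @ \oo --> density R B.
Proof. by []. Qed.

Lemma densityT : density_seq R setT @ \oo --> (1 : R).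
Proof.
apply: cvg_near_cst; near=> n; rewrite density_seqE.
rewrite (eq_bigr (fun=> 1)) => [|i _]; last by rewrite indicT.
rewrite sumr_const card_ord divff// pnatr_eq0 -lt0n.
by near: n; exact: nbhs_infty_gt.
Unshelve. all: by end_near. Qed.

Lemma cvg_densityD B X (b x : R) : X `<=` B ->
  density_seq R B @ \oo --> b -> density_seq R X @ \oo --> x ->
  density_seq R (B `\` X) @ \oo --> b - x.
Proof.
move=> XB Bb Xx; rewrite (_ : density_seq R (B `\` X) =
  density_seq R B \- density_seq R X); first exact: cvgB.
apply/funext => n /=; rewrite !density_seqE -mulrBl -sumrB; congr (_ / _).
apply: eq_bigr => i _; rewrite !indicE in_setD.
have := @XB i; case: (boolP (val i \in B)); case: (boolP (val i \in X)) => /=.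
- by rewrite subrr.
- by rewrite subr0.
- by rewrite inE notin_setE => iX iB h; case: (iB (h iX)).
- by rewrite subr0.
Qed.

Lemma cvg_densityU B X (b x : R) : B `&` X = set0 ->
  density_seq R B @ \oo --> b -> density_seq R X @ \oo --> x ->
  density_seq R (B `|` X) @ \oo --> b + x.
Proof.
move=> BX Bb Xx; rewrite (_ : density_seq R (B `|` X) =
  density_seq R B \+ density_seq R X); first exact: cvgD.
apply/funext => n /=; rewrite !density_seqE -mulrDl -big_split/=; congr (_ / _).
apply: eq_bigr => i _; rewrite !indicE in_setU.
case: (boolP (val i \in B)) => /= iB; last by rewrite add0r.
case: (boolP (val i \in X)) => /= iX; last by rewrite addr0.
have : (B `&` X) i by split; exact: set_mem.
by rewrite BX.
Qed.

(** Unlike [d_independent], this allows the empty family, at which the recursion starts, and the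
    empty intersection, of density [1]. *)
Definition independent A : Prop :=
  [/\ forall X, A X -> 0 < density R X < 1,
      generated_field A `<=` has_density R &
      forall F, finite_set F -> F `<=` A ->
        density R (\bigcap_(X in F) X) = \big[*%R/1]_(X \in F) density R X].

Lemma d_independentE A : d_independent R A <-> A !=set0 /\ independent A.
Proof.
split=> [[[A0 Ad] A1 Ag AF]|[A0 [A1 Ag AF]]].
  split=> //; split=> // F Ff FA; have [->|/set0P F0] := eqVneq F set0.
    by rewrite bigcap_set0 fsbig_set0; have [_ ->] := cvg_density densityT.
  exact: AF.
split=> // [|F Ff _ FA]; last exact: AF.
by split=> // X /sub_generated_field/Ag.
Qed.

Lemma independentS A A' : A' `<=` A -> independent A -> independent A'.
Proof.
move=> A'A [A1 Ag AF]; split=> [X /A'A/A1//|B /(generated_fieldS A'A)/Ag//|F Ff FA'].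
by apply: AF => // X /FA'/A'A.
Qed.

(** A set in the generated field is built from finitely many generators, and the product rule
    concerns finitely many members. *)
Lemma independent_finitary A :
  (forall l : seq (set nat), [set` l] `<=` A -> independent [set` l]) ->
  independent A.
Proof.
move=> Al; split.
- move=> X AX; have [|h _ _] := Al [:: X]; first by move=> Y /=; rewrite inE => /eqP ->.
  by apply: h; rewrite /= mem_head.
- pose C := [set B | exists2 l : seq (set nat), [set` l] `<=` A & generated_field [set` l] B].
  suff gC : generated_field A `<=` C by move=> B /gC[l /Al[_ + _]]; apply.
  apply: generated_field_sub.
    split=> [|B [l lA lB]|B B' [l lA lB] [l' lA' lB']].
    + by exists [::] => //; have [] := generated_field_field [set` [::] : seq (set nat)].
    + by exists l => //; have [_ gC _] := generated_field_field [set` l]; exact: gC.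
    + exists (l ++ l') => [X|].
        by rewrite /= mem_cat => /orP[/lA|/lA'].
      have [_ _ gU] := generated_field_field [set` l ++ l']; apply: gU.
        by apply: generated_fieldS lB => X /= Xl; rewrite mem_cat Xl.
      by apply: generated_fieldS lB' => X /= Xl; rewrite mem_cat Xl orbT.
  move=> X AX; exists [:: X]; first by move=> Y /=; rewrite inE => /eqP ->.
  by apply: sub_generated_field; rewrite /= mem_head.
- by move=> F /finite_seqP[l ->] /[dup]/Al[_ _ h] _; exact: h.
Qed.

Lemma independent_field A X : independent (A `|` [set X]) -> ~ A X ->
  forall B, generated_field A B ->
    density_seq R (B `&` X) @ \oo --> density R B * density R X.
Proof.
move=> [_ Ag AF] nAX.
have gA : generated_field A `<=` generated_field (A `|` [set X]).
  by apply: generated_fieldS => ?; left.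
have gX : generated_field (A `|` [set X]) X by apply: sub_generated_field; right.
(* Carrying a finite intersection along makes the induction go through: a new generator [Y] is
   absorbed into [F]. *)
suff H : generated_field A `<=` [set B | generated_field A B /\
    forall F, finite_set F -> F `<=` A ->
    density R (B `&` \bigcap_(Y in F) Y `&` X) =
    density R (B `&` \bigcap_(Y in F) Y) * density R X].
  move=> B gB; have [_ /(_ set0)] := H B gB.
  rewrite bigcap_set0 setIT => <- //; apply/densityP/Ag.
  by apply: generated_fieldI => //; exact: gA.
apply: generated_field_ind.
- split; first exact: generated_fieldT.
  move=> F Ff FA; rewrite setTI.
  (* [~ A X] keeps [X] out of [F], so that its factor splits off the product. *)
  have FX : (X |` F) `\ X = F.
    apply/seteqP; split=> Y /= => [[[]//]|FY].
    by split; [right|move=> YX; apply: nAX; rewrite -YX; exact: FA].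
  have := AF (X |` F); rewrite bigcap_setU1 (fsbigD1 X)/= ?FX; last first.
  + by left.
  + by rewrite finite_setU; split.
  rewrite setIC => ->.
  + by rewrite mulrC AF// => Y /FA; left.
  + by rewrite finite_setU; split.
  + by move=> Y [->|/FA]; [right|left].
- move=> B Y [gB BF] AY; split.
    by apply: generated_fieldI => //; exact: sub_generated_field.
  move=> F Ff FA; rewrite -(setIA B) -bigcap_setU1; apply: BF.
    by rewrite finite_setU; split.
  by move=> Z [->|/FA].
- move=> B B' B'B [gB BF] [gB' BF']; split; first exact: generated_fieldD.
  move=> F Ff FA; have gF := generated_field_bigcap Ff FA.
  have dP E : generated_field A E ->
      density R (E `&` \bigcap_(Y in F) Y `&` X) =
        density R (E `&` \bigcap_(Y in F) Y) * density R X ->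
      density_seq R (E `&` \bigcap_(Y in F) Y) @ \oo -->
        density R (E `&` \bigcap_(Y in F) Y) /\
      density_seq R (E `&` \bigcap_(Y in F) Y `&` X) @ \oo -->
        density R (E `&` \bigcap_(Y in F) Y) * density R X.
    move=> gE <-; have gEF : generated_field (A `|` [set X]) (E `&` \bigcap_(Y in F) Y).
      by apply: gA; exact: generated_fieldI.
    by split; apply/densityP/Ag => //; exact: generated_fieldI.
  have [h1 h2] := dP B gB (BF F Ff FA).
  have [h1' h2'] := dP B' gB' (BF' F Ff FA).
  have sub : B' `&` \bigcap_(Y in F) Y `<=` B `&` \bigcap_(Y in F) Y.
    exact: setSI.
  have [_] := cvg_density (cvg_densityD sub h1 h1').
  have [_] := cvg_density (cvg_densityD (setSI (C := X) sub) h2 h2').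
  have DIr (E E' G : set nat) : (E `&` G) `\` (E' `&` G) = (E `\` E') `&` G.
    by apply/seteqP; split=> x /=; tauto.
  by rewrite !DIr => -> ->; rewrite mulrBl.
Qed.

(** A converse to [independent_field]. An element of the new field is some [B1] inside [Y] and some
    [B2] outside, and both pieces have a density. *)
Lemma independentU1 A Y (s : R) : independent A -> 0 < s < 1 ->
  (forall B, generated_field A B ->
    density_seq R (B `&` Y) @ \oo --> density R B * s) ->
  independent (A `|` [set Y]).
Proof.
move=> [A1 Ag AF] s01 H.
have dY : density R Y = s.
  have := H _ (@generated_fieldT _ A); rewrite setTI => /cvg_density[_ ->].
  by have [_ ->] := cvg_density densityT; rewrite mul1r.
split.
- by move=> X [/A1//|->]; rewrite dY.
- move=> B /generated_fieldU1[B1 [B2 [g1 g2 ->]]].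
  have h2 := cvg_densityD (@subIsetl _ B2 Y : _ `<=` _) (densityP (Ag _ g2)) (H _ g2).
  rewrite setDIr setDv set0U in h2.
  apply/(proj1 (cvg_density (cvg_densityU _ (H _ g1) h2))).
  by apply/seteqP; split=> x //= [[_ Yx] [_]].
- move=> F Ff FA; have [YF|nYF] := pselect (F Y); last first.
    by apply: AF => // X FX; case: (FA X FX) => // XY; case: nYF; rewrite -XY.
  have FDA : F `\ Y `<=` A by move=> X [/FA[//|->]]; case.
  have fFD : finite_set (F `\ Y) by exact: finite_setD.
  rewrite (fsbigD1 Y)//= -{1}(setD1K YF) bigcap_setU1.
  have [_] := cvg_density (H _ (generated_field_bigcap fFD FDA)).
  by rewrite setIC => ->; rewrite AF// dY mulrC.
Qed.

End density.

(** * The construction *)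

Lemma card_leT_inj (T U : Type) (A : set U) : [set: T] #<= A ->
  exists2 f : T -> U, injective f & forall t, A (f t).
Proof.
move=> /card_leP[f]; pose i (t : T) : [set: T] := exist _ t (mem_set I).
exists (fun t => val (f (i t))) => [t t' /val_inj e|t]; last exact: set_valP.
have : i t = i t' by apply: (inj (f := f)) e; rewrite inE.
by move=> /(congr1 val).
Qed.

(** * Extending a small family by one set *)

Section extension.
Variable R : realType.
Hypothesis hcov : cov_null_eq R [set: set nat].
Implicit Types (B X Y : set nat) (A : set (set nat)).

(** Otherwise the [N w] cover the Cantor space, and the hypothesis on the covering number injects
    the power set of [nat] into [words A], against smallness. *)
Lemma small_avoid A (N : seq (nat + set nat) -> set (nat -> bool)) : small A ->
  (forall w, words A w -> null_ideal R (N w)) ->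
  exists x, forall w, words A w -> ~ N w x.
Proof.
move=> sA Nnull; apply: contrapT => /forallNP nx; apply: sA.
have : [set: set nat] #<= N @` words A.
  apply: (proj2 hcov); split=> [_ [w /Nnull ? <-]//|].
  apply/seteqP; split=> // x _; have /existsNP[w /not_implyP[Aw /contrapT Nx]] := nx x.
  by exists (N w) => //; exists w.
by move=> /card_le_trans/(_ (card_image_le _ _))/card_leT_inj.
Qed.

Lemma random_extension A X (x p q : R) : small A ->
  generated_field A `<=` has_density R ->
  (forall B, generated_field A B ->
    density_seq R (B `&` X) @ \oo --> density R B * x) ->
  0 <= p <= 1 -> 0 <= q <= 1 ->
  exists Y, (forall B, generated_field A B ->
      density_seq R (B `&` Y) @ \oo --> density R B * (p * x + q * (1 - x))) /\
    density_seq R (X `&` Y) @ \oo --> p * x.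
Proof.
move=> sA Ag AX p01 q01.
pose prob n : R := q + (p - q) * \1_X n.
have prob01 n : 0 <= prob n <= 1.
  rewrite /prob indicE; case: (n \in X) => /=; rewrite ?mulr1 ?mulr0 ?addr0//.
  by rewrite addrC subrK.
pose N B : set (nat -> bool) := [set y | ~ ((fun n => (\sum_(i < n)
  \1_B i * (\1_(random_set prob y) i - prob i)) / n%:R : R) @ \oo --> (0 : R))].
have Nnull B : null_ideal R (N B).
  by apply: weighted_lln => // n; rewrite indicE; case: (n \in B); rewrite /= ?lexx ?ler01.
have [y yP] := small_avoid (N := N \o postfix_eval X) sA (fun w _ => Nnull _).
exists (random_set prob y).
(* Stated for the field with [X] added, so as to serve both conclusions; the second one takes
   [B = X] and [b = bx = x]. *)
have H B b bx : generated_field (A `|` [set X]) B -> density_seq R B @ \oo --> b ->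
    density_seq R (B `&` X) @ \oo --> bx ->
    density_seq R (B `&` random_set prob y) @ \oo --> q * b + (p - q) * bx.
  move=> /generated_field_words[w Aw wB] hb hbx.
  have /contrapT := yP w Aw; rewrite /= wB => h.
  rewrite -[q * b + _]add0r.
  have -> : density_seq R (B `&` random_set prob y) = (fun n => (\sum_(i < n)
      \1_B i * (\1_(random_set prob y) i - prob i)) / n%:R : R) \+
      ((fun n => q * density_seq R B n) \+ (fun n => (p - q) * density_seq R (B `&` X) n)).
    apply/funext => n /=; rewrite !density_seqE !mulrA -!mulrDl; congr (_ / _).
    rewrite !mulr_sumr -!big_split/=; apply: eq_bigr => i _.
    by rewrite !indicI /prob /=; ring.
  by apply: cvgD h _; apply: cvgD; apply: cvgMr.
split=> [B gB|].
  have -> : density R B * (p * x + q * (1 - x)) =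
      q * density R B + (p - q) * (density R B * x) by ring.
  apply: H; [|exact/densityP/Ag|exact: AX].
  by apply: generated_fieldS gB => ?; left.
have Xx : density_seq R X @ \oo --> x.
  have := AX _ (@generated_fieldT _ A).
  by have [_ ->] := cvg_density (@densityT R); rewrite setTI mul1r.
have -> : p * x = q * x + (p - q) * x by ring.
apply: H => //; last by rewrite setIid.
by apply: sub_generated_field; right.
Qed.

Lemma blocking_extension A X (s : R) : small A -> independent R A -> 0 < s < 1 ->
  exists Y, [/\ density R Y = s, independent R (A `|` [set Y]) &
    ~ A X -> independent R (A `|` [set X]) ->
    density R (X `&` Y) <> density R X * density R Y].
Proof.
move=> sA iA s01; have [A1 Ag AF] := iA.
have dY Y : (forall B, generated_field A B ->
    density_seq R (B `&` Y) @ \oo --> density R B * s) -> density R Y = s.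
  move=> /(_ _ (@generated_fieldT _ A)); rewrite setTI => /cvg_density[_ ->].
  by have [_ ->] := cvg_density (@densityT R); rewrite mul1r.
(* If [X] is already in [A] or cannot be added, the last clause is vacuous and a random set with the
   single probability [s] suffices. *)
have [[nAX iAX]|nX] := pselect (~ A X /\ independent R (A `|` [set X])); last first.
  have s01' : 0 <= s <= 1 by lra.
  have [|Y [YA _]] := random_extension (X := set0) (x := 0) sA Ag _ s01' s01'.
    move=> B _; rewrite setI0 mulr0; apply: cvg_near_cst; apply: nearW => n.
    rewrite density_seqE big1 ?mul0r// => i _.
    by rewrite indicE in_set0.
  have {}YA B : generated_field A B ->
      density_seq R (B `&` Y) @ \oo --> density R B * s.
    by move=> /YA; rewrite mulr0 subr0 mulr1 add0r.
  exists Y; split; [exact: dY|exact: independentU1 YA|].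
  by move=> nAX iAX; case: nX.
have AX := independent_field iAX nAX.
set x := density R X in AX.
have x01 : 0 < x < 1 by case: iAX => + _ _; apply; right.
(* The minimum of [s] and [1 - s] keeps both probabilities in the unit interval. *)
have [e [e0 e1 e2]] : exists e : R, [/\ 0 < e, e <= s & e <= 1 - s].
  have [h|h] := leP s (1 - s); first by exists s; split=> //; lra.
  by exists (1 - s); split=> //; lra.
have p01 : 0 <= s + e * (1 - x) <= 1 by nra.
have q01 : 0 <= s - e * x <= 1 by nra.
have [Y [YA XY]] := random_extension sA Ag AX p01 q01.
have {}YA B : generated_field A B ->
    density_seq R (B `&` Y) @ \oo --> density R B * s.
  have es : s = (s + e * (1 - x)) * x + (s - e * x) * (1 - x) by ring.
  by rewrite [X in _ * X]es; exact: YA.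
exists Y; split; [exact: dY|exact: independentU1 YA|move=> _ _].
have [_ ->] := cvg_density XY; rewrite (dY Y YA) -/x => h.
have : e * (1 - x) * x = 0 by move: h; lra.
have : 0 < e * (1 - x) * x by rewrite !mulr_gt0//; lra.
by move=> /lt0r_neq0/eqP.
Qed.

End extension.

(** A real is recovered from the codes of the rationals below it. This lets the subsets of [nat]
    index all of [S]. *)
Lemma set_nat_surj_real (R : realType) :
  exists f : set nat -> R, forall r, exists A, f A = r.
Proof.
pose cut (r : R) := [set choice.pickle q | q in [set q : rat | ratr q < r]].
have cutS r r' : cut r `<=` cut r' -> r <= r'.
  move=> h; rewrite leNgt; apply/negP => /rat_in_itvoo[q]; rewrite in_itv/= => /andP[q1 q2].
  have [|q' /= q'r /(pcan_inj choice.pickleK) e] := h (choice.pickle q).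
    by exists q.
  by move: q'r; rewrite e ltNge (ltW q1).
have cutI : injective cut.
  by move=> r r' e; apply/eqP; rewrite eq_le !cutS// e.
exists (fun A => xget 0 [set r | cut r = A]) => r; exists (cut r).
by case: xgetP => [r' _ /= /cutI ->//|/(_ r)[]].
Qed.

Lemma independent0 (R : realType) : independent R set0.
Proof.
split=> // [|F _].
  apply: generated_field_ind => // [|B B' B'B dB dB'].
    by have [] := cvg_density (@densityT R).
  exact: (cvg_density (cvg_densityD B'B (densityP dB) (densityP dB'))).1.
rewrite subset0 => ->; rewrite bigcap_set0 fsbig_set0.
by have [_ ->] := cvg_density (@densityT R).
Qed.

(** Finitely many indices have a largest one [u], and the family up to [u] is independent by
    hypothesis. This serves each stage of the recursion as well as the final union. *)
Lemma independent_chain (R : realType) (T : Type) (lt : T -> T -> Prop)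
    (Y : T -> set nat) (D : set T) : strict_total lt ->
  (forall u, D u -> independent R (Y @` [set v | lt v u] `|` [set Y u])) ->
  independent R (Y @` D).
Proof.
move=> [_ tr tot] iD; apply: independent_finitary => l lD.
have [->|[u [Du]]] : l = [::] \/ exists u, D u /\
    [set` l] `<=` Y @` [set v | lt v u] `|` [set Y u].
  elim: l lD => [|X l IH] lD; first by left.
  right; have [u Du YuX] : (Y @` D) X by apply: lD; rewrite /= mem_head.
  have [|->|[v [Dv lv]]] := IH.
  - by move=> Z Zl; apply: lD; rewrite /= in_cons Zl orbT.
  - by exists u; split=> // Z /=; rewrite inE => /eqP ->; right.
  have [uv|uv|vu] := tot u v.
  - exists v; split=> // Z /=; rewrite in_cons => /orP[/eqP ->|/lv//].
    by left; exists u.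
  - exists v; split=> // Z /=; rewrite in_cons => /orP[/eqP ->|/lv//].
    by right; rewrite -YuX uv.
  - exists u; split=> // Z /=; rewrite in_cons => /orP[/eqP ->|/lv]; first by right.
    by move=> [[w wv <-]|->]; left; [exists w => //; exact: tr vu|exists v].
- rewrite (_ : [set` [::]] = set0); first exact: independent0.
  by apply/seteqP; split.
- by move=> /independentS; apply; exact: iD.
Qed.

Theorem theorem2p9 (R : realType)
    (hcov : cov_null_eq R [set: set nat])
    (S : set R) (hS : S `<=` `]0, 1[%classic) (hS0 : S !=set0) :
  exists A : set (set nat),
    maximal_d_independent R A /\ density R @` A = S.
Proof.
have [s0 Ss0] := hS0.
(* Every stage is assigned a density in [S]; indices whose real lies outside [S] get [s0]. *)
have [sigma sigmaS sigma_surj] : exists2 f : set nat -> R,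
    (forall X, S (f X)) & forall s, S s -> exists X, f X = s.
  have [f fS] := set_nat_surj_real R.
  exists (fun X => if pselect (S (f X)) then f X else s0) => [X|s Ss].
    by case: pselect.
  by have [X fX] := fS s; exists X; rewrite fX; case: pselect.
have [lt ltT lts] := exists_small_wf_order; have [wf tr tot] := ltT.
(* The index [X] of a stage is also the set to be blocked there, so every subset of [nat] gets its
   turn. *)
pose spec A X Y := density R Y = sigma X /\ (small A -> independent R A ->
  independent R (A `|` [set Y]) /\ (~ A X -> independent R (A `|` [set X]) ->
    density R (X `&` Y) <> density R X * density R Y)).
pose step X (prev : forall Z, lt Z X -> set nat) : set nat :=
  get (spec [set Z | exists U (UX : lt U X), prev U UX = Z] X).
pose Y := Fix wf (fun=> set nat) step.
have YE X : Y X = get (spec (Y @` [set Z | lt Z X]) X).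
  rewrite /Y Fix_eq => [|U f g fg].
    congr (get (spec _ X)); apply/seteqP; split=> Z /=.
      by move=> [U [UX <-]]; exists U.
    by move=> [U UX <-]; exists U, UX.
  by congr (step U _); do 2 apply: functional_extensionality_dep => ?.
(* [get] is known to meet [spec] only once a witness exists, hence the assumption on the earlier
   stages; [iY] then discharges it by induction. *)
have YP X : independent R (Y @` [set Z | lt Z X]) ->
    spec (Y @` [set Z | lt Z X]) X (Y X).
  move=> iX; rewrite YE; apply: getPex.
  have sX : 0 < sigma X < 1 by have := hS _ (sigmaS X); rewrite /= in_itv.
  have [Z [dZ iZ bZ]] := blocking_extension hcov X (small_image (Y := Y) (lts X)) iX sX.
  by exists Z; split.
have iY X : independent R (Y @` [set Z | lt Z X]).
  elim/(well_founded_ind wf): X => X IH.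
  apply: independent_chain ltT _ => U UX.
  have [_ h] := YP U (IH _ UX).
  by have [] := h (small_image (Y := Y) (lts U)) (IH _ UX).
have {}YP X : [/\ density R (Y X) = sigma X,
    independent R (Y @` [set Z | lt Z X] `|` [set Y X]) &
    ~ (Y @` [set Z | lt Z X]) X ->
    independent R (Y @` [set Z | lt Z X] `|` [set X]) ->
    density R (X `&` Y X) <> density R X * density R (Y X)].
  by have [? /(_ (small_image (Y := Y) (lts X)) (iY X))[]] := YP X (iY X).
exists (range Y); split; last first.
  apply/seteqP; split=> [_ [_ [X _ <-] <-]|s /sigma_surj[X <-]].
    by have [-> _ _] := YP X.
  by exists (Y X) => //; have [] := YP X.
split.
  apply/d_independentE; split; first by exists (Y set0), set0.
  by apply: independent_chain ltT _ => U _; have [] := YP U.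
move=> B /d_independentE[_ iB] YB; apply/seteqP; split=> // X BX.
apply: contrapT => nYX.
have [_ _ block] := YP X.
apply: block.
- by move=> [Z _ ZX]; apply: nYX; exists Z.
- by apply: independentS iB => _ [[Z _ <-]|->] //; apply: YB; exists Z.
(* [X] is outside the range of [Y], so it differs from [Y X]; the product rule in [B] for this pair
   is what stage [X] has excluded. *)
have nYX' : (X |` [set Y X]) `\ X = [set Y X].
  apply/seteqP; split=> Z /= => [[[]//]|->].
  by split; [right|move=> YXX; apply: nYX; exists X].
have [_ _ /(_ (X |` [set Y X]))] := iB.
rewrite bigcap_setU1 bigcap_set1 (fsbigD1 X)/= ?nYX' ?fsbig_set1; last 2 first.
- by rewrite finite_setU; split.
- by left.
apply; first by rewrite finite_setU; split.
by move=> Z [->//|->]; apply: YB; exists X.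
Qed.
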